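(* For all integers $n \geq 3$, $B_1(C_n)=2$ if $n=2^k$ for some positive integer $k$, and $B_1(C_n)=3$ otherwise. Moreover, if $n \neq 2^k$ for every positive integer $k$, then $\mathrm{Spec}(C_n, 1)=\{2,3\}$ if $n$ is even and $\mathrm{Spec}(C_n, 1)=\{3\}$ if $n$ is odd.
   Context: $C_n$ is the cycle with vertex set $\mathbb{Z}_n=\{0,1,\dots,n-1\}$, $i$ adjacent to $i\pm1 \pmod n$; the graph distance is $\mathrm{dist}(i,j)=\min(|i-j|,\,n-|i-j|)$, and the set of positive distances realized is $\{1,\dots,\lfloor n/2\rfloor\}$. For a set $D$ of positive integers, the distance graph $G(C_n,D)$ has vertex set $\mathbb{Z}_n$, with distinct $i,j$ adjacent iff $\mathrm{dist}(i,j)\in D$; $\chi(C_n,D)$ is its chromatic number. $B_k(C_n)=\max\{\chi(C_n,D): D\subseteq\{1,\dots,\lfloor n/2\rfloor\},\ |D|=k\}$ and $\mathrm{Spec}(C_n,k)=\{\chi(C_n,D): D\subseteq\{1,\dots,\lfloor n/2\rfloor\},\ |D|=k\}$. *)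

(* Defs.v *)
From HB Require Import structures.
From mathcomp Require Import all_boot all_order all_algebra.
From mathcomp Require Import finmap zify.

Set Implicit Arguments.
Unset Strict Implicit.
Unset Printing Implicit Defensive.

Import IntDist.

Record sgraph := SGraph {
  vertex :> finType;
  edge : rel vertex;
  edge_sym : symmetric edge;
  edge_irrefl : irreflexive edge
}.

Definition colorable (G : sgraph) (k : nat) : bool :=
  [exists f : {ffun G -> 'I_k},
    [forall x, forall y, edge x y ==> (f x != f y)]].

Lemma colorable_ex (G : sgraph) : exists k, colorable G k.
Proof.
exists #|G|; apply/existsP; exists [ffun x => enum_rank x].
apply/forallP => x; apply/forallP => y; apply/implyP => xy.
rewrite !ffunE (inj_eq enum_rank_inj).
by apply: contraTneq xy => ->; rewrite edge_irrefl.
Qed.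

Definition chromatic (G : sgraph) : nat := ex_minn (colorable_ex G).

(* Here `|i - j| is the absolute difference of two naturals, so the outer
   subtraction is never truncated. *)
Definition cdist (n : nat) (i j : 'I_n) : nat :=
  minn `|i - j| (n - `|i - j|).

Definition cycle_adj (n : nat) : rel 'I_n :=
  [rel i j : 'I_n | (j == i.+1 %[mod n]) || (i == j.+1 %[mod n])].

Lemma cdistC (n : nat) (i j : 'I_n) : cdist i j = cdist j i.
Proof. by rewrite /cdist distnC. Qed.

Lemma cdist_adj (n : nat) (i j k : 'I_n) :
  cycle_adj i j -> cdist i k <= (cdist j k).+1.
Proof.
case: i j k => [i hi] [j hj] [k hk]; rewrite /cycle_adj /cdist /=.
rewrite (modn_small hi) (modn_small hj).
have md (a : nat) : a < n -> a.+1 %% n = if a.+1 == n then 0 else a.+1.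
  by move=> ha; case: eqP => [->|ne]; [rewrite modnn | rewrite modn_small; lia].
rewrite !md //; do 2 case: ifP; lia.
Qed.

Lemma cdist_step (n : nat) (i k : 'I_n) :
  0 < cdist i k -> exists2 j, cycle_adj i j & cdist i k = (cdist j k).+1.
Proof.
case: i k => [i hi] [k hk]; rewrite /cycle_adj /cdist /= => d0.
have md (a : nat) : a < n -> a.+1 %% n = if a.+1 == n then 0 else a.+1.
  by move=> ha; case: eqP => [->|ne]; [rewrite modnn | rewrite modn_small; lia].
have up : (i.+1 %% n) < n by rewrite ltn_mod; lia.
have dn : (if i is i'.+1 then i' else n.-1) < n by case: (i) hi => *; lia.
have [le|gt] := leqP (minn `|(i.+1 %% n) - k| (n - `|(i.+1 %% n) - k|)).+1
                     (minn `|i - k| (n - `|i - k|)).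
  exists (Ordinal up) => /=; first by rewrite modn_mod eqxx.
  by move: le; rewrite md //; case: ifP; lia.
exists (Ordinal dn) => /=; last first.
  by move: gt; rewrite md //; case: ifP; case: (i) hi d0 {up dn}; lia.
apply/orP; right; case: (i) hi => [|i'] hi //=.
by rewrite prednK // modnn mod0n.
Qed.

(* cdist is the length of a shortest path of the cycle. *)
Lemma cdist_shortest (n : nat) (i j : 'I_n) :
  (exists p, [/\ path (@cycle_adj n) i p, last i p = j & size p = cdist i j])
  /\ (forall p, path (@cycle_adj n) i p -> last i p = j -> cdist i j <= size p).
Proof.
split.
  move: {2}(cdist i j) (erefl (cdist i j)) => d.
  elim: d i => [|d IH] i Ed.
    exists [::]; rewrite Ed; split=> //=; apply/val_inj => /=.
    by move: Ed (ltn_ord i) (ltn_ord j); rewrite /cdist; lia.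
  have [|k ik Ek] := @cdist_step n i j; first by rewrite Ed.
  have [|p [pp pl ps]] := IH k; first by lia.
  by exists (k :: p); rewrite /= ik pp Ek ps.
move=> p; elim: p i => [|k p IH] i /=; first by move=> _ ->; rewrite /cdist; lia.
by move=> /andP[ik pp] pl; apply: leq_trans (cdist_adj j ik) _; apply: IH.
Qed.

Definition dist_edge (n : nat) (D : {pred nat}) : rel 'I_n :=
  [rel i j : 'I_n | (i != j) && (cdist i j \in D)].

Lemma dist_edge_sym (n : nat) (D : {pred nat}) : symmetric (@dist_edge n D).
Proof. by move=> i j; rewrite /dist_edge /= eq_sym cdistC. Qed.

Lemma dist_edge_irrefl (n : nat) (D : {pred nat}) :
  irreflexive (@dist_edge n D).
Proof. by move=> i; rewrite /dist_edge /= eqxx. Qed.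

Definition dist_graph (n : nat) (D : {pred nat}) : sgraph :=
  SGraph (@dist_edge_sym n D) (@dist_edge_irrefl n D).

Definition chi (n : nat) (D : {fset nat}) : nat :=
  chromatic (dist_graph n (mem D)).

Local Open Scope fset_scope.

Definition dist_range (n : nat) : {fset nat} := [fset d in iota 1 (n %/ 2)].

Definition dist_sets (n k : nat) : {fset {fset nat}} :=
  [fset D in fpowerset (dist_range n) | #|` D| == k].

(* The junk value 0 occurs only when k > n %/ 2, so that there is no D. *)
Definition B (k n : nat) : nat :=
  \max_(D <- dist_sets n k) chi n D.

Definition Spec (n k : nat) : {fset nat} :=
  [fset chi n D | D in dist_sets n k].

Lemma in_dist_sets (n k : nat) (D : {fset nat}) :
  (D \in dist_sets n k) =
  [forall d : D, 1 <= val d <= n %/ 2] && (#|` D| == k).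
Proof.
rewrite !inE /= fpowersetE; congr (_ && _).
apply/fsubsetP/forallP => [sD d | sD d dD].
  by have := sD _ (valP d); rewrite !inE /= mem_iota; lia.
by have := sD [` dD]; rewrite !inE /= mem_iota; lia.
Qed.

(* Main.v *)
Require Import Defs.
From mathcomp Require Import all_boot finmap.
From mathcomp Require Import zify.

Set Implicit Arguments.
Unset Strict Implicit.
Unset Printing Implicit Defensive.

(** For [1 <= d <= n / 2] the distance graph of [{d}] is 2-colourable iff the
    2-part of [n] does not divide [d].  If it does not, twice the 2-part [g] of
    [d] divides [n], so that [d] and [n - d] are both odd multiples of [g] and
    the parity of [i / g] is a proper colouring.  If it does, walking by steps
    of [d] closes up after as many steps as the odd part of [n].  Three colours
    always suffice: colour 2 on the last [d] vertices, and colours 0 and 1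
    alternating on the successive blocks of length [d] of the others.  Finally,
    a multiple of the 2-part of [n] occurs among the distances iff [n] is not a
    power of 2, and a non-multiple occurs iff [n] is even. *)

Lemma dvdn_mul_partn (p n d : nat) : prime p -> 0 < n -> 0 < d ->
  (p * d`_p %| n) = ~~ (n`_p %| d).
Proof.
by move=> p_pr n_gt0 d_gt0; rewrite !p_part -expnS !pfactor_dvdn // -ltnNge.
Qed.

Lemma odd_partn2' (n : nat) : odd n`_2^'.
Proof. by rewrite odd_2'nat part_pnat. Qed.

Lemma pnat_powP (p n : nat) : prime p -> 1 < n ->
  reflect (exists2 k, 0 < k & n = p ^ k) (p.-nat n).
Proof.
move=> p_pr n_gt1; apply: (iffP idP) => [/p_natP[k n_eq]|[k _ ->]].
  by exists k => //; case: k n_eq n_gt1 => // ->.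
by rewrite pnatX pnat_id.
Qed.

Lemma iter_ordS (n k : nat) (i : 'I_n) :
  iter k (@ordS n) i = (i + k) %% n :> nat.
Proof.
elim: k => [|k IHk]; first by rewrite addn0 modn_small.
by rewrite iterS /= IHk -addn1 modnDml addn1 addnS.
Qed.

Section Colouring.

Variable G : sgraph.

Lemma colorableP (k : nat) :
  reflect (exists2 f : G -> nat, forall x, f x < k
                               & forall x y, edge x y -> f x != f y)
          (colorable G k).
Proof.
apply: (iffP existsP) => [[f /forallP fP]|[f f_lt fP]].
  exists (fun x => f x : nat) => // x y xy.
  by have /forallP/(_ y)/implyP := fP x; apply.
exists [ffun x => Ordinal (f_lt x)].
by do 2![apply/forallP => ?]; apply/implyP => /fP; rewrite !ffunE.
Qed.

Lemma colorable_leq (k l : nat) : k <= l -> colorable G k -> colorable G l.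
Proof.
move=> le_kl /colorableP[f f_lt fP]; apply/colorableP.
by exists f => // x; apply: leq_trans le_kl.
Qed.

Lemma chromatic_leq (k : nat) : (chromatic G <= k) = colorable G k.
Proof.
rewrite /chromatic; case: ex_minnP => m col_m min_m.
by apply/idP/idP => [/colorable_leq|/min_m //]; apply.
Qed.

Lemma chromatic_eqS (k : nat) :
  (chromatic G == k.+1) = colorable G k.+1 && ~~ colorable G k.
Proof. by rewrite eqn_leq chromatic_leq ltnNge chromatic_leq. Qed.

Lemma edge_Ncolorable1 (x y : G) : edge x y -> ~~ colorable G 1.
Proof.
move=> xy; apply/colorableP => -[f f_lt /(_ x y xy)].
by case: (f x) (f y) (f_lt x) (f_lt y) => [|?] [|?].
Qed.

Lemma colorable2_even_closed_walk (x : G) (p : seq G) :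
  colorable G 2 -> path (@edge G) x p -> last x p = x -> ~~ odd (size p).
Proof.
case/colorableP => f f_lt fP.
have f_last y q : path (@edge G) y q ->
    (f (last y q) == f y) = ~~ odd (size q).
  elim: q y => [|z q IHq] y /=; first by rewrite eqxx.
  case/andP => /fP yz /IHq; move: (f_lt (last z q)) (f_lt y) (f_lt z); lia.
by move=> /f_last <- ->.
Qed.

End Colouring.

Section DistanceGraph.

Variables (n : nat) (D : {pred nat}).

Lemma dist_graph_colorable (k : nat) (c : nat -> nat) :
    (forall x, c x < k) ->
    (forall x y, x < y < n -> minn (y - x) (n - (y - x)) \in D -> c x != c y) ->
  colorable (dist_graph n D) k.
Proof.
move=> c_lt cP; apply/colorableP; exists (fun i : 'I_n => c i) => //= i j.
wlog lt_ij : i j / i < j.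
  move=> IHc; have [/IHc //|/IHc c_ji|/val_inj ->] := ltngtP i j.
    by rewrite eq_sym dist_edge_sym.
  by rewrite dist_edge_irrefl.
have cdist_ij : cdist i j = minn (j - i) (n - (j - i)) by rewrite /cdist; lia.
by case/andP => _; rewrite cdist_ij; apply: cP; rewrite lt_ij ltn_ord.
Qed.

Lemma dist_graph_colorable2 (g : nat) : 2 * g %| n ->
    {in D, forall d, exists2 k, odd k & d = k * g} ->
  colorable (dist_graph n D) 2.
Proof.
case/dvdnP => m n_eq D_odd.
apply: (dist_graph_colorable (c := fun x => odd (x %/ g))) => [x|x y].
  by case: odd.
case/andP => lt_xy lt_yn /D_odd[k k_odd d_eq].
have g_gt0 : 0 < g by lia.
have [l l_odd y_eq] : exists2 l, odd l & y = l * g + x.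
  have [le_d|lt_d] := leqP (y - x) (n - (y - x)); first by exists k; lia.
  have le_k : k <= m * 2 by rewrite -(leq_pmul2r g_gt0) -mulnA -n_eq; lia.
  exists (m * 2 - k); first by rewrite oddB // oddM andbF.
  by rewrite mulnBl -mulnA -n_eq; lia.
by rewrite y_eq divnMDl // oddD l_odd; case: odd.
Qed.

Variable d : nat.
Hypotheses (dD : d \in D) (d_gt0 : 0 < d) (d_le : d <= n %/ 2).

Lemma dist_edge_rot (i : 'I_n) : dist_edge D i (iter d (@ordS n) i).
Proof.
have i_lt := ltn_ord i; set j := iter _ _ _.
have j_eq : j = (if i + d < n then i + d else i + d - n) :> nat.
  rewrite iter_ordS; case: ltnP => [/modn_small //|le_n].
  by rewrite -[in LHS](subnK le_n) modnDr modn_small //; lia.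
have cdist_ij : cdist i j = d by rewrite /cdist j_eq; case: ifP; lia.
rewrite /dist_edge /= cdist_ij [d \in D]dD andbT.
by apply: contraTneq d_gt0 => ij; rewrite -cdist_ij -ij /cdist; lia.
Qed.

Lemma dist_graph_Ncolorable1 : ~~ colorable (dist_graph n D) 1.
Proof.
have n_gt0 : 0 < n by lia.
exact: (@edge_Ncolorable1 (dist_graph n D) _ _ (dist_edge_rot (Ordinal n_gt0))).
Qed.

Lemma dist_graph_Ncolorable2 :
  n`_2 %| d -> ~~ colorable (dist_graph n D) 2.
Proof.
move=> n2_d; have n_gt0 : 0 < n by lia.
pose i0 := Ordinal n_gt0; pose rot := iter d (@ordS n).
apply: contraL (odd_partn2' n) => col2.
rewrite -(size_traject rot (rot i0) n`_2^').
apply: (@colorable2_even_closed_walk (dist_graph n D) i0) => //.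
  apply: sub_path (fpath_traject rot i0 _) => i _ /eqP <-.
  exact: dist_edge_rot.
apply/ord_inj; rewrite last_traject -iterM iter_ordS /= add0n.
by apply/eqP; rewrite -/(_ %| _) -{1}(partnC 2 n_gt0) mulnC dvdn_mul.
Qed.

End DistanceGraph.

Section SingleDistance.

Variables n d : nat.
Hypotheses (d_gt0 : 0 < d) (d_le : d <= n %/ 2).

Let G := dist_graph n (mem [fset d]%fset).

Let dD : d \in mem [fset d]%fset. Proof. exact: fset11. Qed.

Lemma dist_graph_fset1_colorable3 : colorable G 3.
Proof.
pose c x := if n - d <= x then 2 else odd (x %/ d) : nat.
apply: (dist_graph_colorable (c := c)) => [x|x y].
  by rewrite /c; case: ifP => // _; case: odd.
case/andP => lt_xy lt_yn; rewrite inE => /eqP d_eq.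
have [y_eq|[lt_x le_y]] : y = x + d \/ x < n - d /\ n - d <= y by lia.
  rewrite /c y_eq leqNgt ifF; last by lia.
  by rewrite divnDr // divnn d_gt0 oddD addbT; case: ifP; case: odd.
by rewrite /c le_y leqNgt lt_x; case: odd.
Qed.

Lemma dist_graph_fset1_colorable2 : colorable G 2 = ~~ (n`_2 %| d).
Proof.
apply/idP/idP => [|n2_d].
  by apply: contraL; apply: dist_graph_Ncolorable2 dD _ _.
apply: (@dist_graph_colorable2 _ _ d`_2).
  by rewrite dvdn_mul_partn //; lia.
move=> _ /fset1P ->; exists d`_2^'; first exact: odd_partn2'.
by rewrite mulnC partnC.
Qed.

Lemma chi_fset1 : chi n [fset d]%fset = if n`_2 %| d then 3 else 2.
Proof.
apply/eqP; have := dist_graph_fset1_colorable2.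
case: (_ %| _) => /= col2; rewrite chromatic_eqS col2 ?andbT //=.
  exact: dist_graph_fset1_colorable3.
exact: dist_graph_Ncolorable1 dD _ _.
Qed.

End SingleDistance.

Local Open Scope fset_scope.

Lemma B_bigmax_Spec (k n : nat) : B k n = \max_(c <- Spec n k) c.
Proof.
apply/eqP; rewrite eqn_leq; apply/andP; split; apply/bigmax_leqP_seq.
  move=> D D_nk _; have chi_nk : chi n D \in Spec n k by apply: in_imfset.
  exact: (leq_bigmax_seq _ chi_nk).
by move=> _ /imfsetP[D D_nk ->] _; apply: leq_bigmax_seq.
Qed.

Lemma dist_sets1P (n : nat) (D : {fset nat}) :
  reflect (exists2 d, 0 < d <= n %/ 2 & D = [fset d]) (D \in dist_sets n 1).
Proof.
rewrite in_dist_sets.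
apply: (iffP andP) => [[/forallP D_le /cardfs1P[d D_eq]]|[d d_le ->]].
  have dD : d \in D by rewrite D_eq inE.
  by exists d => //; exact: D_le [` dD].
split; last by rewrite cardfs1.
by apply/forallP => -[x /= /fset1P ->].
Qed.

Lemma Spec1P (n c : nat) :
  reflect (exists2 d, 0 < d <= n %/ 2 & c = if n`_2 %| d then 3 else 2)
          (c \in Spec n 1).
Proof.
apply: (iffP (imfsetP _ _ _ _)) => [[D /= /dist_sets1P[d d_le ->] ->]|].
  by exists d => //; case/andP: d_le => *; rewrite chi_fset1.
case=> d d_le ->; exists [fset d]; first by apply/dist_sets1P; exists d.
by case/andP: d_le => *; rewrite chi_fset1.
Qed.

Lemma mem2_Spec1 (n : nat) : 1 < n -> (2 \in Spec n 1) = ~~ odd n.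
Proof.
move=> n_gt1; have n_gt0 := ltnW n_gt1.
have -> : odd n = (n`_2 == 1) by rewrite partn_eq1 // odd_2'nat.
apply/Spec1P/idP => [[d _]|n2_neq1].
  by apply: contra_eqN => /eqP ->; rewrite dvd1n.
by exists 1; rewrite ?dvdn1 ?(negbTE n2_neq1) // divn_gt0.
Qed.

Lemma mem3_Spec1 (n : nat) : 0 < n -> (3 \in Spec n 1) = ~~ 2.-nat n.
Proof.
move=> n_gt0; apply/Spec1P/idP => [[d /andP[d_gt0 d_le]]|n_Npow2].
  case: ifP => // n2_d _; apply: contraTN d_le => n_pow2.
  move: n2_d; rewrite part_pnat_id // => /(dvdn_leq d_gt0); lia.
exists n`_2; last by rewrite dvdnn.
rewrite part_gt0 leq_divRL // -[leqRHS](partnC 2) // leq_pmul2l ?part_gt0 //.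
have : n`_2^' != 1 by rewrite partn_eq1 // pnatNK.
by have := part_gt0 2^' n; lia.
Qed.

Lemma mem_Spec1 (n c : nat) : 1 < n ->
  (c \in Spec n 1) = (c == 2) && ~~ odd n || (c == 3) && ~~ 2.-nat n.
Proof.
move=> n_gt1; rewrite -mem2_Spec1 // -(mem3_Spec1 (ltnW n_gt1)).
apply/idP/idP => [c_Spec|]; last by case/orP=> /andP[/eqP ->].
have [d _ c_eq] := Spec1P _ _ c_Spec.
by move: c_eq c_Spec => ->; case: ifP => _ ->.
Qed.

Lemma Spec1E (n : nat) : 1 < n ->
  Spec n 1 = if 2.-nat n then [fset 2]
             else if odd n then [fset 3] else [fset 2; 3].
Proof.
move=> n_gt1; have odd_Npow2 : 2.-nat n -> ~~ odd n.
  move=> n_pow2; apply: contraL n_gt1; rewrite odd_2'nat => n_odd.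
  by rewrite (pnat_1 n_pow2 n_odd).
apply/fsetP => c; rewrite mem_Spec1 //; case: ifP => [/odd_Npow2 ->|_].
  by rewrite andbT andbF orbF inE.
by case: odd; rewrite ?andbT ?andbF !inE.
Qed.

Lemma B1E (n : nat) : 1 < n -> B 1 n = if 2.-nat n then 2 else 3.
Proof.
move=> n_gt1; rewrite B_bigmax_Spec Spec1E //.
by do 2?case: ifP => _; rewrite ?big_fsetU1 ?inE // !big_seq_fset1.
Qed.

Theorem theorem3p1p1 (n : nat) (hn : 3 <= n) :
  [/\ (exists2 k, 0 < k & n = 2 ^ k) -> B 1 n = 2,
      ~ (exists2 k, 0 < k & n = 2 ^ k) -> B 1 n = 3
    & (forall k, 0 < k -> n <> 2 ^ k) ->
      (~~ odd n -> Spec n 1 = [fset 2; 3]) /\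
      (odd n -> Spec n 1 = [fset 3])].
Proof.
have n_gt1 : 1 < n := ltnW hn.
have pow2P := pnat_powP (isT : prime 2) n_gt1.
rewrite B1E // Spec1E //; split=> [/pow2P -> //|/pow2P/negbTE -> //|n_Npow2].
have /pow2P/negbTE -> : ~ exists2 k, 0 < k & n = 2 ^ k.
  by case=> k /n_Npow2.
by case: odd.
Qed.
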